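(* Let $n\ge 2$ and let $\mathcal{H}^n=\{(y_0,y_1,\dots,y_n)\in\mathbb{R}^{n+1}\mid -y_0^2+y_1^2+\dots+y_n^2=-1,\ y_0>0\}$ be the hyperbolic space modelled as a hyperboloid in Minkowski space $M^{n+1}$, with the Riemannian metric induced from the Lorentzian metric $-dy_0^2+dy_1^2+\dots+dy_n^2$. Let $h:\mathbb{R}^{n-1}\to\mathbb{C}$ be a non-constant function harmonic with respect to the Euclidean metric on $\mathbb{R}^{n-1}$, let $r\ge 1$ be an integer, and let $p_r:\mathbb{R}^+\to\mathbb{C}$ be given by $p_r(t)=(a_r+b_r t^{n-1})\cdot\log(t)^{r-1}$, where $(a_r,b_r)\in\mathbb{C}^2$ is non-zero. Then the function $f:\mathcal{H}^n\to\mathbb{C}$ given by $$f(y_0,y_1,\dots,y_n)=p_r\Bigl(\frac{2\sqrt{y_0^2-y_1^2-\dots-y_n^2}}{y_0+y_1}\Bigr)\cdot h\Bigl(\frac{2y_2}{y_0+y_1},\dots,\frac{2y_n}{y_0+y_1}\Bigr)$$ is proper $r$-harmonic on $\mathcal{H}^n$.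
   Context: For a Riemannian manifold $(M,g)$ the Laplace–Beltrami operator (tension field) acts on complex-valued functions by $\tau(f)=\sum_{i,j}\frac{1}{\sqrt{|g|}}\frac{\partial}{\partial x_j}\bigl(g^{ij}\sqrt{|g|}\frac{\partial f}{\partial x_i}\bigr)$ in local coordinates. Iterates: $\tau^0(f)=f$, $\tau^r(f)=\tau(\tau^{r-1}(f))$. A function $f$ is $r$-harmonic if $\tau^r(f)=0$, and proper $r$-harmonic if moreover $\tau^{r-1}(f)$ does not vanish identically. *)

(* Defs.v *)
From HB Require Import structures.
From mathcomp Require Import all_boot all_order all_algebra.
From mathcomp Require Import all_classical all_reals all_analysis.
From mathcomp Require Import complex.
Set Implicit Arguments. Unset Strict Implicit. Unset Printing Implicit Defensive.
Import Order.TTheory GRing.Theory Num.Theory.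
Import numFieldNormedType.Exports.
Local Open Scope ring_scope.
Local Open Scope complex_scope.

Section Defs.
Variable R : realType.

Definition evec (k : nat) (i : 'I_k) : 'rV[R]_k := delta_mx 0 i.

Definition pd (k : nat) (i : 'I_k) (F : 'rV[R]_k -> R[i]) (x : 'rV[R]_k) : R[i] :=
  ('D_(evec i) (fun z => complex.Re (F z)) x) +i*
  ('D_(evec i) (fun z => complex.Im (F z)) x).

Definition iter_pd (k : nat) (s : seq 'I_k) (F : 'rV[R]_k -> R[i]) :
  'rV[R]_k -> R[i] := foldr (fun i G => pd i G) F s.

Definition smoothC (k : nat) (F : 'rV[R]_k -> R[i]) : Prop :=
  forall (s : seq 'I_k) (x : 'rV[R]_k),
    differentiable (fun z => complex.Re (iter_pd s F z)) x /\
    differentiable (fun z => complex.Im (iter_pd s F z)) x.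

Definition eucl_laplacian (k : nat) (F : 'rV[R]_k -> R[i]) (x : 'rV[R]_k) : R[i] :=
  \sum_(j < k) pd j (pd j F) x.

Definition eucl_harmonic (k : nat) (F : 'rV[R]_k -> R[i]) : Prop :=
  smoothC F /\ forall x, eucl_laplacian F x = 0.

Definition minkowski (n : nat) (u v : 'rV[R]_n.+1) : R :=
  \sum_(k < n.+1) (if k == ord0 then -1 else 1) * u 0 k * v 0 k.

Definition hyperboloid (n : nat) : set 'rV[R]_n.+1 :=
  [set y | minkowski y y = -1 /\ 0 < y 0 ord0].

(* global chart of H^n: (y_1,..,y_n) |-> (sqrt(1 + |y|^2), y_1, ..., y_n) *)
Definition hyp_chart (n : nat) (y : 'rV[R]_n) : 'rV[R]_n.+1 :=
  \row_(k < n.+1) (if unlift ord0 k is Some j then y 0 j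
                   else Num.sqrt (1 + \sum_(j < n) y 0 j ^+ 2)).

(* induced Riemannian metric g_ij in the chart (pullback of the Lorentzian metric) *)
Definition hyp_metric (n : nat) (y : 'rV[R]_n) : 'M[R]_n :=
  \matrix_(i < n, j < n)
    minkowski ('D_(evec i) (@hyp_chart n) y) ('D_(evec j) (@hyp_chart n) y).

Definition hyp_sqrtdet (n : nat) (y : 'rV[R]_n) : R := Num.sqrt (\det (hyp_metric y)).

(* Laplace-Beltrami operator (tension field) in the chart:
   tau(F) = sum_{i,j} 1/sqrt|g| d_j ( g^{ij} sqrt|g| d_i F ) *)
Definition hyp_tau (n : nat) (F : 'rV[R]_n -> R[i]) (y : 'rV[R]_n) : R[i] :=
  \sum_(i < n) \sum_(j < n)
    (hyp_sqrtdet y)^-1%:C *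
    pd j (fun z => ((invmx (hyp_metric z)) i j * hyp_sqrtdet z)%:C * pd i F z) y.

(* a function f on H^n (given on the ambient space; only its values on H^n
   matter), read in the chart *)
Definition in_chart (n : nat) (f : 'rV[R]_n.+1 -> R[i]) : 'rV[R]_n -> R[i] :=
  f \o (@hyp_chart n).

Definition hyp_r_harmonic (n r : nat) (f : 'rV[R]_n.+1 -> R[i]) : Prop :=
  forall y, iter r (@hyp_tau n) (in_chart f) y = 0.

Definition hyp_proper_r_harmonic (n r : nat) (f : 'rV[R]_n.+1 -> R[i]) : Prop :=
  hyp_r_harmonic r f /\ exists y, iter r.-1 (@hyp_tau n) (in_chart f) y != 0.

Definition p_fun (n r : nat) (a b : R[i]) (t : R) : R[i] :=
  (a + b * (t ^+ n.-1)%:C) * ((ln t) ^+ r.-1)%:C.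

Definition thm_f (n r : nat) (a b : R[i]) (h : 'rV[R]_n.-1 -> R[i])
  (y : 'rV[R]_n.+1) : R[i] :=
  let s := y 0 ord0 + y 0 (inord 1) in
  p_fun n r a b (2 * Num.sqrt (- minkowski y y) / s) *
  h (\row_(j < n.-1) (2 * y 0 (inord j.+2) / s)).

End Defs.

(* Main.v *)
(** Write [s = y_0 + y_1] on the hyperboloid. The functions [u = ln (2 / s)] and
    [x_k = 2 y_(k+1) / s] are the logarithm of the vertical and the horizontal
    coordinates of the upper half-space model; together with
    [|grad u| = 1], [tau u = -(n-1)], [<grad u, grad x_k> = 0], [tau x_k = 0] and
    [<grad x_k, grad x_l> = (2/s)^2 delta_kl] this gives, for [H] harmonic,
    [tau (w(u) H(x)) = (w'' - (n-1) w')(u) H(x)].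
    For [w = P + Q e^((n-1)u)] with polynomials [P, Q], the operator
    [w'' - (n-1) w'] acts as [P'' - (n-1) P'] on [P] and as [Q'' + (n-1) Q'] on
    [Q]: each lowers the degree by exactly one, so [P = Q = u^(r-1)] is killed
    by the [r]-th iterate and becomes a pair of nonzero constants at step [r-1]. *)
Require Import Defs.
From HB Require Import structures.
From mathcomp Require Import all_boot all_order all_algebra.
From mathcomp Require Import all_classical all_reals all_analysis.
From mathcomp Require Import complex ring.
Set Implicit Arguments.
Unset Strict Implicit.
Unset Printing Implicit Defensive.
Import Order.TTheory GRing.Theory Num.Theory.
Import numFieldNormedType.Exports.
Local Open Scope ring_scope.
Local Open Scope complex_scope.

(** * Gradients on row vectors *)

Section Gradient.
Context {R : realType}.
Local Notation ev i := (@evec R _ i).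

Lemma row_evec n (v : 'rV[R]_n) : v = \sum_i v 0 i *: ev i.
Proof. exact: row_sum_delta. Qed.

(** The chain rule needs total differentiability, which partial derivatives alone do not give, so
    the rules below propagate both together. *)
Definition has_grad n (f : 'rV[R]_n -> R) y (G : 'I_n -> R) :=
  differentiable f y /\ forall i, 'D_(ev i) f y = G i.

Section Rules.
Context {n : nat}.
Implicit Types (f g : 'rV[R]_n -> R) (y : 'rV[R]_n) (F G : 'I_n -> R).

Lemma derivable_evec f y i : differentiable f y -> derivable f y (ev i).
Proof. exact: diff_derivable. Qed.

Lemma has_grad_eq f y F G : has_grad f y F -> F =1 G -> has_grad f y G.
Proof. by move=> [df Df] FG; split=> // i; rewrite Df. Qed.

Lemma has_grad_cst (c : R) y : has_grad (fun=> c) y (fun=> 0).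
Proof.
split=> [|i]; first exact: (differentiable_cst c y).
exact: (derive_cst c y (ev i)).
Qed.

Lemma has_grad_coord k y : has_grad (fun z => z 0 k) y (fun i => (i == k)%:R).
Proof.
split=> [|i]; first exact: differentiable_coord.
have dI : derivable (fun z : 'rV[R]_n => z) y (ev i) by exact: derivable_id.
have := derive_mx dI; rewrite [X in X = _](derive_id y (ev i)).
by move=> /matrixP/(_ 0 k); rewrite !mxE eqxx eq_sym => ->.
Qed.

Lemma has_gradD f g y F G : has_grad f y F -> has_grad g y G ->
  has_grad (fun z => f z + g z) y (fun i => F i + G i).
Proof.
move=> [df Df] [dg Dg]; split=> [|i]; first exact: differentiableD.
by rewrite [LHS]deriveD ?Df ?Dg //; exact: derivable_evec.
Qed.

Lemma has_grad_sum m (f : 'I_m -> 'rV[R]_n -> R) y (F : 'I_m -> 'I_n -> R) :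
  (forall k, has_grad (f k) y (F k)) ->
  has_grad (fun z => \sum_k f k z) y (fun i => \sum_k F k i).
Proof.
move=> fF; have -> : (fun z => \sum_k f k z) = \sum_k f k.
  by apply/funext => z; rewrite fct_sumE.
split=> [|i]; first by apply: differentiable_sum => k; have [] := fF k.
rewrite derive_sum => [|k]; first by apply: eq_bigr => k _; have [] := fF k.
by apply: derivable_evec; have [] := fF k.
Qed.

Lemma has_gradM f g y F G : has_grad f y F -> has_grad g y G ->
  has_grad (fun z => f z * g z) y (fun i => F i * g y + f y * G i).
Proof.
move=> [df Df] [dg Dg]; split=> [|i]; first exact: differentiableM.
rewrite [LHS]deriveM; try exact: derivable_evec.
by rewrite Df Dg /GRing.scale /= addrC mulrC [in RHS]addrC [in LHS]addrC.
Qed.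

Lemma has_grad_comp1 (w : R -> R) (w' : R) f y F :
  is_derive (f y) 1 w w' -> has_grad f y F ->
  has_grad (fun z => w (f z)) y (fun i => w' * F i).
Proof.
move=> [dw Dw] [df Df]; have dw' : differentiable w (f y) by exact/derivable1_diffP.
have dwf := differentiable_comp df dw'.
split=> // i; rewrite [LHS]deriveE // diff_comp //= -[X in 'd w _ X]deriveE // Df.
by rewrite diff1E // derive1E Dw /GRing.scale /= mulrC.
Qed.

Lemma has_gradV f y F : f y != 0 -> has_grad f y F ->
  has_grad (fun z => (f z)^-1) y (fun i => - (f y) ^- 2 * F i).
Proof.
move=> f0; apply: has_grad_comp1.
by have := @is_deriveV R id (f y) 1 1 f0 (is_derive_id _ _); rewrite /GRing.scale /= mulr1.
Qed.

End Rules.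

(** A map with differentiable coordinates is differentiable, being the sum of its coordinates times
    basis vectors; the linear differential of [H] is then expanded in the same basis. *)
Lemma has_grad_comp n m (H : 'rV[R]_m -> R) (x : 'rV[R]_n -> 'rV[R]_m) y DH X :
  has_grad H (x y) DH -> (forall k, has_grad (fun z => x z 0 k) y (X k)) ->
  has_grad (fun z => H (x z)) y (fun i => \sum_k DH k * X k i).
Proof.
move=> [dH HD] xX; have dx : differentiable x y.
  have -> : x = \sum_k (fun z => x z 0 k *: ev k).
    by apply/funext => z; rewrite fct_sumE -row_evec.
  by apply: differentiable_sum => k; apply: differentiableZl; have [] := xX k.
have dHx := differentiable_comp dx dH.
split=> // i; rewrite [LHS]deriveE // diff_comp //= -[X in 'd H _ X]deriveE //.
rewrite derive_mx; last exact: diff_derivable.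
rewrite [X in 'd H _ X]row_evec linear_sum; apply: eq_bigr => k _.
rewrite linearZ /= -deriveE // HD mxE; have [_ ->] := xX k.
by rewrite /GRing.scale /= mulrC.
Qed.

End Gradient.

(** * The induced metric in the global chart *)

(* Both sides are the determinant of [block_mx 1 v u 1]. *)
Lemma det_1Bmul (R : comUnitRingType) n (u : 'cV[R]_n) (v : 'rV[R]_n) :
  \det (1%:M - u *m v) = 1 - (v *m u) 0 0.
Proof.
have E1 : block_mx 1%:M v u 1%:M =
  block_mx 1%:M 0 u 1%:M *m block_mx (1%:M : 'M[R]_1) v 0 (1%:M - u *m v).
  by rewrite mulmx_block !mul1mx !mulmx1 ?mul0mx ?mulmx0 ?addr0 ?add0r [u *m v + _]addrC subrK.
have E2 : block_mx 1%:M v u 1%:M =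
  block_mx (1%:M : 'M[R]_1) v 0 1%:M *m block_mx (1%:M - v *m u) 0 u 1%:M.
  by rewrite mulmx_block !mul1mx ?mulmx1 ?mul0mx ?mulmx0 ?add0r subrK.
have := congr1 determinant E1; rewrite E2 !det_mulmx !(det_lblock, det_ublock).
by rewrite !det1 !mul1r mulr1 => <-; rewrite det_mx11 !mxE eqxx.
Qed.

Section Chart.
Context {R : realType} {n : nat}.
Local Notation ev i := (@evec R _ i).
Implicit Types (y z : 'rV[R]_n).

Definition height y := Num.sqrt (1 + \sum_(j < n) y 0 j ^+ 2).

Lemma height_sq y : height y ^+ 2 = 1 + \sum_(j < n) y 0 j ^+ 2.
Proof. by rewrite sqr_sqrtr // addr_ge0 // sumr_ge0 // => j _; exact: sqr_ge0. Qed.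

Lemma height_gt0 y : 0 < height y.
Proof. by rewrite sqrtr_gt0 ltr_pwDl // sumr_ge0 // => j _; exact: sqr_ge0. Qed.

Lemma height_neq0 y : height y != 0.
Proof. by rewrite gt_eqF ?height_gt0. Qed.

Lemma sum_sqr y : \sum_(j < n) y 0 j * y 0 j = height y ^+ 2 - 1.
Proof. by rewrite height_sq addrAC subrr add0r. Qed.

Lemma has_grad_height y : has_grad height y (fun i => y 0 i / height y).
Proof.
have y0 : 0 < 1 + \sum_(j < n) y 0 j ^+ 2 by rewrite -height_sq exprn_gt0 ?height_gt0.
have := has_grad_comp1 (is_derive1_sqrt y0)
  (has_gradD (has_grad_cst 1 y) (has_grad_sum (fun j =>
     has_gradM (has_grad_coord j y) (has_grad_coord j y)))).
move/has_grad_eq; apply => i.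
rewrite add0r -/(height y); under eq_bigr do rewrite mulrC -mulrDr mulrC.
rewrite (bigD1 i) //= big1 => [|k ki]; last first.
  by rewrite eq_sym (negbTE ki) addr0 mul0r.
by rewrite eqxx mulr1n; have h0 := height_neq0 y; field.
Qed.

Lemma hyp_chart0 y : hyp_chart y 0 ord0 = height y.
Proof. by rewrite mxE unlift_none. Qed.

Lemma hyp_chart_lift y j : hyp_chart y 0 (lift ord0 j) = y 0 j.
Proof. by rewrite mxE liftK. Qed.

Lemma minkowskiE (u v : 'rV[R]_n.+1) : Defs.minkowski u v =
  - (u 0 ord0 * v 0 ord0) + \sum_(j < n) u 0 (lift ord0 j) * v 0 (lift ord0 j).
Proof.
rewrite /Defs.minkowski big_ord_recl /= mulN1r mulNr; congr (_ + _).
by apply: eq_bigr => j _; rewrite mul1r.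
Qed.

Lemma minkowski_chart y : Defs.minkowski (hyp_chart y) (hyp_chart y) = -1.
Proof.
rewrite minkowskiE hyp_chart0 -expr2.
under eq_bigr do rewrite hyp_chart_lift.
by rewrite sum_sqr addrA addNr add0r.
Qed.

Lemma derive_chart i y : 'D_(ev i) (@hyp_chart R n) y =
  \row_k (if unlift ord0 k is Some j then (i == j)%:R else y 0 i / height y).
Proof.
have chartE k : has_grad (fun z => hyp_chart z 0 k) y (fun i =>
    if unlift ord0 k is Some j then (i == j)%:R else y 0 i / height y).
  case: unliftP => [j|] ->.
    under eq_fun do rewrite hyp_chart_lift.
    exact: has_grad_coord.
  under eq_fun do rewrite hyp_chart0.
  exact: has_grad_height.
rewrite derive_mx; last first.
  apply/derivable_mxP => a k; rewrite (ord1 a).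
  by apply: derivable_evec; have [] := chartE k.
by apply/rowP => k; rewrite !mxE; have [_ ->] := chartE k.
Qed.

(** The spatial components contribute the identity and the time component a negative rank-one term.
    This shape gives determinant and inverse in closed form. *)
Lemma hyp_metricE y :
  hyp_metric y = 1%:M - (height y ^- 2 *: y^T) *m y.
Proof.
apply/matrixP => i j; rewrite mxE !derive_chart minkowskiE !mxE unlift_none.
rewrite (bigD1 j) //= big1 => [|k kj]; last first.
  by rewrite !mxE liftK eq_sym (eq_sym j) (negbTE kj) mulr0.
rewrite !mxE liftK eqxx mulr1 addr0 big_ord1 !mxE.
by have h0 := height_neq0 y; move: (i == j)%:R => d; field.
Qed.

(** By [det_1Bmul] the determinant is 1 - |y|^2 / y_0^2, and |y|^2 = y_0^2 - 1. *)
Lemma hyp_sqrtdetE y : hyp_sqrtdet y = (height y)^-1.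
Proof.
rewrite /hyp_sqrtdet hyp_metricE det_1Bmul -scalemxAr mxE mxE.
under eq_bigr do rewrite [y^T _ _]mxE.
rewrite sum_sqr.
have -> : 1 - height y ^- 2 * (height y ^+ 2 - 1) = (height y)^-1 ^+ 2.
  by have h0 := height_neq0 y; field.
by rewrite sqrtr_sqr ger0_norm // invr_ge0 ltW ?height_gt0.
Qed.

Lemma invmx_metricE y i j :
  invmx (hyp_metric y) i j = (i == j)%:R + y 0 i * y 0 j.
Proof.
have h0 := height_neq0 y.
(* The inverse of a rank-one perturbation of the identity is again of that form (Sherman-Morrison);
   here the candidate is checked by multiplication. *)
have inv : hyp_metric y *m (1%:M + y^T *m y) = 1%:M.
  rewrite hyp_metricE mulmxBl mul1mx mulmxDr mulmx1 -scalemxAl.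
  rewrite -scalemxAl mulmxA -[y^T *m y *m y^T]mulmxA.
  have -> : y *m y^T = (height y ^+ 2 - 1)%:M.
    apply/matrixP => a b; rewrite !ord1 !mxE eqxx mulr1n -sum_sqr.
    by apply: eq_bigr => k _; rewrite mxE.
  rewrite mul_mx_scalar -scalemxAl scalerA -scalerDl.
  rewrite -[X in X - _]scale1r.
  have -> : height y ^- 2 + height y ^- 2 * (height y ^+ 2 - 1) = 1 by field.
  by rewrite !scale1r addrK.
have [gu _] := mulmx1_unit inv.
have -> : invmx (hyp_metric y) = 1%:M + y^T *m y.
  by rewrite -[RHS](mulKmx gu) inv mulmx1.
by rewrite !mxE big_ord1 !mxE.
Qed.

End Chart.

(** * Half-space coordinates *)

Section HalfSpace.
Context {R : realType} {n : nat}.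
Local Notation ev i := (@evec R _ i).
Implicit Types (y z : 'rV[R]_n.+1).

(** From here on the hyperbolic space has dimension [n.+1]. Chart index 0 stands for y_1, and
    [lift ord0 k] for y_(k+2), with [k] counted from 0. *)
Definition null_coord y := height y + y 0 0.

(** Since y_0^2 is at least 1 + y_1^2, the absolute value of y_1 is below y_0. *)
Lemma null_coord_gt0 y : 0 < null_coord y.
Proof.
rewrite /null_coord -ltrBlDr sub0r; apply: le_lt_trans (ler_norm _) _.
rewrite normrN -(@ltr_pXn2r _ 2) ?nnegrE //; last by rewrite ltW ?height_gt0.
rewrite height_sq big_ord_recl real_normK ?num_real // addrCA ltrDl.
by rewrite ltr_pwDl // sumr_ge0 // => j _; exact: sqr_ge0.
Qed.

Lemma null_coord_neq0 y : null_coord y != 0.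
Proof. by rewrite gt_eqF ?null_coord_gt0. Qed.

Definition log_depth y := ln (2 / null_coord y).

Definition horo y : 'rV[R]_n :=
  \row_k (2 * y 0 (lift ord0 k) / null_coord y).

(* With [B = 1 + sum v_k^2], solve [height y + y 0 0 = s], [height y - y 0 0 = B / s]. *)
Lemma horo_surj (s : R) (x : 'rV[R]_n) : 0 < s -> exists y, null_coord y = s /\ horo y = x.
Proof.
move=> s0; pose v k := x 0 k * s / 2; pose B := 1 + \sum_k v k ^+ 2.
have B0 : 0 < B by rewrite ltr_pwDl // sumr_ge0 // => k _; exact: sqr_ge0.
pose y : 'rV[R]_n.+1 :=
  \row_i (if unlift ord0 i is Some k then v k else (s - B / s) / 2).
have y0 : y 0 0 = (s - B / s) / 2 by rewrite mxE unlift_none.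
have yv k : y 0 (lift ord0 k) = v k by rewrite mxE liftK.
have hy : height y = (s + B / s) / 2.
  rewrite /height big_ord_recl y0; under eq_bigr do rewrite yv.
  have -> : 1 + (((s - B / s) / 2) ^+ 2 + \sum_(i < n) v i ^+ 2)
    = ((s + B / s) / 2) ^+ 2.
    by rewrite addrCA -/B; field; rewrite gt_eqF.
  rewrite sqrtr_sqr ger0_norm // divr_ge0 // addr_ge0 ?ltW // divr_gt0 //.
have ys : null_coord y = s.
  by rewrite /null_coord hy y0; field; rewrite gt_eqF.
exists y; split=> //; apply/rowP => k; rewrite mxE ys yv /v; field.
by rewrite gt_eqF.
Qed.

(** * Differentials, fluxes and divergences of the half-space coordinates *)

Definition dlog_depth y i : R :=
  - (null_coord y)^-1 * (y 0 i / height y + (i == 0)%:R).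

Definition dhoro k y i : R :=
  2 / null_coord y * (i == lift ord0 k)%:R
  - 2 * y 0 (lift ord0 k) / null_coord y ^+ 2 * (y 0 i / height y + (i == 0)%:R).

Lemma has_grad_null y :
  has_grad null_coord y (fun i => y 0 i / height y + (i == 0)%:R).
Proof. exact: has_gradD (has_grad_height y) (has_grad_coord 0 y). Qed.

Lemma has_grad_null_inv y : has_grad (fun z => (null_coord z)^-1) y
  (fun i => - null_coord y ^- 2 * (y 0 i / height y + (i == 0)%:R)).
Proof. exact: has_gradV (null_coord_neq0 y) (has_grad_null y). Qed.

Lemma has_grad_height_inv y : has_grad (fun z => (height z)^-1) y
  (fun i => - height y ^- 2 * (y 0 i / height y)).
Proof. exact: has_gradV (height_neq0 y) (has_grad_height y). Qed.

Lemma has_grad_log_depth y : has_grad log_depth y (dlog_depth y).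
Proof.
have t0 : 0 < 2 / null_coord y by rewrite divr_gt0 ?null_coord_gt0.
have := has_grad_comp1 (is_derive1_ln t0)
  (has_gradM (has_grad_cst 2 y) (has_grad_null_inv y)).
move/has_grad_eq; apply => i; rewrite /dlog_depth.
move: (_ + (i == 0)%:R) => c; have S0 := null_coord_neq0 y; field.
by rewrite S0.
Qed.

Lemma has_grad_horo k y : has_grad (fun z => horo z 0 k) y (dhoro k y).
Proof.
under eq_fun do rewrite mxE.
have := has_gradM (has_gradM (has_grad_cst 2 y) (has_grad_coord (lift ord0 k) y))
  (has_grad_null_inv y).
move/has_grad_eq; apply => i; rewrite /dhoro.
move: (_ + (i == 0)%:R) (_ == _)%:R => c d; have S0 := null_coord_neq0 y; field.
by rewrite S0.
Qed.

Lemma sum_deltar m (f : 'I_m -> R) p : \sum_j f j * (j == p)%:R = f p.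
Proof.
rewrite (bigD1 p) //= big1 => [|j jp]; first by rewrite eqxx mulr1 addr0.
by rewrite (negbTE jp) mulr0.
Qed.

(* Gradients and fluxes of [u] and [x_k] are combinations of [y] and of basis
   vectors, so that all their inner products are instances of this formula. *)
Lemma sum_lincomb y p q (a1 a2 a3 b1 b2 b3 : R) :
  \sum_j (a1 * y 0 j + a2 * (j == 0)%:R + a3 * (j == p)%:R) *
         (b1 * y 0 j + b2 * (j == 0)%:R + b3 * (j == q)%:R) =
  a1 * b1 * (height y ^+ 2 - 1) + (a1 * b2 + a2 * b1) * y 0 0
  + a1 * b3 * y 0 q + a3 * b1 * y 0 p + a2 * b2 + a2 * b3 * (q == 0)%:R
  + a3 * b2 * (p == 0)%:R + a3 * b3 * (p == q)%:R.
Proof.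
pose L j := a1 * y 0 j + a2 * (j == 0)%:R + a3 * (j == p)%:R.
have -> : \sum_j L j * (b1 * y 0 j + b2 * (j == 0)%:R + b3 * (j == q)%:R) =
    b1 * \sum_j L j * y 0 j + b2 * L 0 + b3 * L q.
  rewrite -(sum_deltar L 0) -(sum_deltar L q) !mulr_sumr -!big_split /=.
  by apply: eq_bigr => j _; ring.
have -> : \sum_j L j * y 0 j = a1 * (height y ^+ 2 - 1) + a2 * y 0 0 + a3 * y 0 p.
  rewrite -sum_sqr -(sum_deltar (y 0) 0) -(sum_deltar (y 0) p) !mulr_sumr.
  by rewrite -!big_split /=; apply: eq_bigr => j _; rewrite /L; ring.
rewrite /L eqxx (eq_sym 0 p) (eq_sym q p).
move: (_ == _)%:R (_ == _)%:R (_ == _)%:R => d1 d2 d3; rewrite mulr1n; ring.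
Qed.

(* The fluxes [sqrt |g| grad u] and [sqrt |g| grad x_k]; see [dual_log_depth] and
   [dual_horo]. *)
Definition log_field j y := - (height y)^-1 * (y 0 j + (j == 0)%:R / null_coord y).

Definition horo_field k j y : R := 2 * (height y)^-1 * (null_coord y)^-1 *
  ((j == lift ord0 k)%:R - y 0 (lift ord0 k) / null_coord y * (j == 0)%:R).

Definition dlog_field j y i : R :=
  - (- height y ^- 2 * (y 0 i / height y)) * (y 0 j + (j == 0)%:R / null_coord y)
  - (height y)^-1 * ((i == j)%:R - (j == 0)%:R / null_coord y ^+ 2 *
                       (y 0 i / height y + (i == 0)%:R)).

Lemma has_grad_log_field j y : has_grad (log_field j) y (dlog_field j y).
Proof.
have := has_gradM (has_gradM (has_grad_cst (-1) y) (has_grad_height_inv y))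
  (has_gradD (has_grad_coord j y)
     (has_gradM (has_grad_cst (j == 0)%:R y) (has_grad_null_inv y))).
rewrite /log_field; under eq_fun do rewrite mulN1r.
move/has_grad_eq; apply => i; rewrite /dlog_field.
move: (_ + (i == 0)%:R) (_ == _)%:R (_ == _)%:R => c d e.
by have S0 := null_coord_neq0 y; have h0 := height_neq0 y; field; rewrite S0 h0.
Qed.

(** Multiplied by [height y], the inverse of sqrt |g|, this is tau u = -n in dimension [n.+1]. *)
Lemma div_log_field y : \sum_j dlog_field j y j = - n%:R / height y.
Proof.
have S0 := null_coord_neq0 y; have h0 := height_neq0 y.
(* The zero coefficients only pad each factor to the shape required by [sum_lincomb]; the constant
   term is summed separately and contributes [n.+1] times. *)
have E j : dlog_field j y j =
  (height y ^- 3 * y 0 j + 0 * (j == 0)%:R + 0 * (j == 0)%:R) *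
  (1 * y 0 j + (null_coord y)^-1 * (j == 0)%:R + 0 * (j == 0)%:R)
  + (- (height y)^-1 +
  (0 * y 0 j + (null_coord y ^- 2 / height y) * (j == 0)%:R + 0 * (j == 0)%:R) *
  ((height y)^-1 * y 0 j + 1 * (j == 0)%:R + 0 * (j == 0)%:R)).
  rewrite /dlog_field eqxx; move: (j == 0)%:R => d; rewrite mulr1n; field.
  by rewrite S0 h0.
under eq_bigr do rewrite E.
rewrite !big_split /= !sum_lincomb eqxx mulr1n sumr_const card_ord -[X in _ + (X + _)]mulr_natr -natr1.
(* The identity depends on s = y_0 + y_1, so [null_coord] has to be unfolded for [field]. *)
move: S0; rewrite /null_coord => S0; field; by rewrite S0 h0.
Qed.

Definition dhoro_field k j y i : R :=
  2 * (- height y ^- 3 / null_coord y * y 0 i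
       - (height y)^-1 / null_coord y ^+ 2 * (y 0 i / height y + (i == 0)%:R)) *
    ((j == lift ord0 k)%:R - y 0 (lift ord0 k) / null_coord y * (j == 0)%:R)
  - 2 * (height y)^-1 * (null_coord y)^-1 * (j == 0)%:R *
    ((i == lift ord0 k)%:R / null_coord y -
     y 0 (lift ord0 k) / null_coord y ^+ 2 * (y 0 i / height y + (i == 0)%:R)).

Lemma has_grad_horo_field k j y :
  has_grad (horo_field k j) y (dhoro_field k j y).
Proof.
have := has_gradM (has_gradM (has_gradM (has_grad_cst 2 y) (has_grad_height_inv y))
    (has_grad_null_inv y))
  (has_gradD (has_grad_cst (j == lift ord0 k)%:R y)
    (has_gradM (has_grad_cst (-1) y)
      (has_gradM (has_gradM (has_grad_coord (lift ord0 k) y) (has_grad_null_inv y))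
         (has_grad_cst (j == 0)%:R y)))).
rewrite /horo_field; under eq_fun do rewrite mulN1r.
move/has_grad_eq; apply => i; rewrite /dhoro_field.
move: (_ + (i == 0)%:R) (j == 0)%:R (i == lift _ _)%:R (j == lift _ _)%:R => c d e f.
by have S0 := null_coord_neq0 y; have h0 := height_neq0 y; field; rewrite S0 h0.
Qed.

(** This is tau x_k = 0 in divergence form. *)
Lemma div_horo_field k y : \sum_j dhoro_field k j y j = 0.
Proof.
have S0 := null_coord_neq0 y; have h0 := height_neq0 y.
set q := lift ord0 k; set c := y 0 q.
pose A := - 2 * height y ^- 3 / null_coord y - 2 * height y ^- 2 / null_coord y ^+ 2.
pose B := - 2 * (height y)^-1 / null_coord y ^+ 2.
have E j : dhoro_field k j y j =
  (A * y 0 j + B * (j == 0)%:R + 0 * (j == 0)%:R) *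
  (0 * y 0 j + (- c / null_coord y) * (j == 0)%:R + 1 * (j == q)%:R) +
  (0 * y 0 j + - 2 * (height y)^-1 / null_coord y * (j == 0)%:R + 0 * (j == 0)%:R) *
  (- c / null_coord y ^+ 2 / height y * y 0 j + - c / null_coord y ^+ 2 * (j == 0)%:R
    + (null_coord y)^-1 * (j == q)%:R).
  rewrite /dhoro_field /A /B -/q -/c; move: (j == 0)%:R (j == q)%:R => d e; field.
  by rewrite S0 h0.
under eq_bigr do rewrite E.
rewrite !big_split /= !sum_lincomb eqxx /A /B -/c.
have -> : (q == 0) = false by [].
rewrite mulr1n mulr0n.
move: S0; rewrite /null_coord => S0; field; by rewrite S0 h0.
Qed.

(* Raises an index and multiplies by [sqrt |g|]: the flux of a covector field. *)
Definition dual y (c : 'I_n.+1 -> R) j :=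
  \sum_i ((i == j)%:R + y 0 i * y 0 j) / height y * c i.

Lemma dual_log_depth y j : dual y (dlog_depth y) j = log_field j y.
Proof.
have S0 := null_coord_neq0 y; have h0 := height_neq0 y.
have E i : ((i == j)%:R + y 0 i * y 0 j) / height y * dlog_depth y i =
  (y 0 j / height y * y 0 i + 0 * (i == 0)%:R + (height y)^-1 * (i == j)%:R) *
  (- (null_coord y)^-1 / height y * y 0 i + - (null_coord y)^-1 * (i == 0)%:R
    + 0 * (i == 0)%:R).
  rewrite /dlog_depth; move: (i == j)%:R (i == 0)%:R => d e; field.
  by rewrite S0 h0.
rewrite /dual; under eq_bigr do rewrite E.
rewrite sum_lincomb /log_field.
move: (j == 0)%:R => d; move: S0; rewrite /null_coord => S0; field.
by rewrite S0 h0.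
Qed.

Lemma dual_horo k y j : dual y (dhoro k y) j = horo_field k j y.
Proof.
have S0 := null_coord_neq0 y; have h0 := height_neq0 y.
set q := lift ord0 k; set c := y 0 q.
have E i : ((i == j)%:R + y 0 i * y 0 j) / height y * dhoro k y i =
  (y 0 j / height y * y 0 i + 0 * (i == 0)%:R + (height y)^-1 * (i == j)%:R) *
  (- 2 * c / null_coord y ^+ 2 / height y * y 0 i
    + - 2 * c / null_coord y ^+ 2 * (i == 0)%:R + 2 / null_coord y * (i == q)%:R).
  rewrite /dhoro -/q -/c; move: (i == j)%:R (i == 0)%:R (i == q)%:R => d e f; field.
  by rewrite S0 h0.
rewrite /dual; under eq_bigr do rewrite E.
rewrite sum_lincomb /horo_field -/q -/c.
move: (j == 0)%:R (j == q)%:R => d e; move: S0; rewrite /null_coord => S0; field.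
by rewrite S0 h0.
Qed.

(** A differential paired with a flux is sqrt |g| = 1 / [height y] times the metric inner product,
    so this says |grad u| = 1. *)
Lemma log_log y : \sum_j dlog_depth y j * log_field j y = (height y)^-1.
Proof.
have S0 := null_coord_neq0 y; have h0 := height_neq0 y.
have E i : dlog_depth y i * log_field i y =
  (- (null_coord y)^-1 / height y * y 0 i + - (null_coord y)^-1 * (i == 0)%:R
    + 0 * (i == 0)%:R) *
  (- (height y)^-1 * y 0 i + - (height y)^-1 / null_coord y * (i == 0)%:R
   + 0 * (i == 0)%:R).
  rewrite /dlog_depth /log_field; move: (i == 0)%:R => e; field.
  by rewrite S0 h0.
under eq_bigr do rewrite E.
rewrite sum_lincomb eqxx mulr1n.
move: S0; rewrite /null_coord => S0; field.
by rewrite S0 h0.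
Qed.

Lemma horo_log k y : \sum_j dhoro k y j * log_field j y = 0.
Proof.
have S0 := null_coord_neq0 y; have h0 := height_neq0 y.
set q := lift ord0 k; set c := y 0 q.
have E i : dhoro k y i * log_field i y =
  (- 2 * c / null_coord y ^+ 2 / height y * y 0 i
    + - 2 * c / null_coord y ^+ 2 * (i == 0)%:R + 2 / null_coord y * (i == q)%:R) *
  (- (height y)^-1 * y 0 i + - (height y)^-1 / null_coord y * (i == 0)%:R
   + 0 * (i == 0)%:R).
  rewrite /dhoro /log_field -/q -/c; move: (i == 0)%:R (i == q)%:R => e f; field.
  by rewrite S0 h0.
under eq_bigr do rewrite E.
rewrite sum_lincomb eqxx -/c; have -> : (q == 0) = false by [].
rewrite mulr1n mulr0n.
move: S0; rewrite /null_coord => S0; field.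
by rewrite S0 h0.
Qed.

(** The same orthogonality as in [horo_log] with differential and flux exchanged; the product rule
    in [rtau_separated] produces both orders. *)
Lemma log_horo k y : \sum_j dlog_depth y j * horo_field k j y = 0.
Proof.
have S0 := null_coord_neq0 y; have h0 := height_neq0 y.
set q := lift ord0 k; set c := y 0 q.
have E i : dlog_depth y i * horo_field k i y =
  (- (null_coord y)^-1 / height y * y 0 i + - (null_coord y)^-1 * (i == 0)%:R
    + 0 * (i == 0)%:R) *
  (0 * y 0 i + - 2 * c / null_coord y ^+ 2 / height y * (i == 0)%:R
    + 2 / null_coord y / height y * (i == q)%:R).
  rewrite /dlog_depth /horo_field -/q -/c; move: (i == 0)%:R (i == q)%:R => e f; field.
  by rewrite S0 h0.
under eq_bigr do rewrite E.
rewrite sum_lincomb eqxx -/c; have -> : (q == 0) = false by [].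
rewrite mulr1n mulr0n.
move: S0; rewrite /null_coord => S0; field.
by rewrite S0 h0.
Qed.

(** Up to sqrt |g|, this is the horizontal block t^2 delta_kl of the inverse half-space metric, with
    t = 2 / s. *)
Lemma horo_horo l k y : \sum_j dhoro l y j * horo_field k j y =
  4 / (height y * null_coord y ^+ 2) * (l == k)%:R.
Proof.
have S0 := null_coord_neq0 y; have h0 := height_neq0 y.
set q := lift ord0 k; set c := y 0 q; set p := lift ord0 l; set d := y 0 p.
have E i : dhoro l y i * horo_field k i y =
  (- 2 * d / null_coord y ^+ 2 / height y * y 0 i
    + - 2 * d / null_coord y ^+ 2 * (i == 0)%:R + 2 / null_coord y * (i == p)%:R) *
  (0 * y 0 i + - 2 * c / null_coord y ^+ 2 / height y * (i == 0)%:R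
    + 2 / null_coord y / height y * (i == q)%:R).
  rewrite /dhoro /horo_field -/q -/c -/p -/d.
  move: (i == 0)%:R (i == q)%:R (i == p)%:R => e f g; field.
  by rewrite S0 h0.
under eq_bigr do rewrite E.
rewrite sum_lincomb -/c -/d; have -> : (q == 0) = false by [].
have -> : (p == 0) = false by [].
have -> : (p == q) = (l == k) by rewrite (inj_eq lift_inj).
rewrite mulr0n; move: (l == k)%:R => g.
move: S0; rewrite /null_coord => S0; field.
by rewrite S0 h0.
Qed.

End HalfSpace.

(** * The Laplace-Beltrami operator on separated functions *)

Section Operator.
Context {R : realType}.
Local Notation ev i := (@evec R _ i).

Lemma eq_derive (V : normedModType R) (f g : V -> R) v y :
  f =1 g -> 'D_v f y = 'D_v g y.
Proof. by move=> /funext ->. Qed.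

Definition rtau n (f : 'rV[R]_n -> R) y := \sum_i \sum_j (hyp_sqrtdet y)^-1 *
  'D_(ev j) (fun z => invmx (hyp_metric z) i j * hyp_sqrtdet z * 'D_(ev i) f z) y.

Lemma realM_complex (c : R) (z : R[i]) :
  c%:C * z = (c * complex.Re z) +i* (c * complex.Im z).
Proof. by case: z => a b; apply/eqP; rewrite eq_complex /= !mul0r subr0 addr0 !eqxx. Qed.

Lemma sum_complex m (A B : 'I_m -> R) :
  \sum_i (A i +i* B i) = (\sum_i A i) +i* (\sum_i B i).
Proof. by apply: (big_rec3 (fun a b c => a = b +i* c)) => // i a b c _ ->. Qed.

(** The coefficients of the operator are real, so it acts separately on real and imaginary parts. *)
Lemma hyp_tau_rtau n (F : 'rV[R]_n -> R[i]) y : hyp_tau F y =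
  rtau (fun z => complex.Re (F z)) y +i* rtau (fun z => complex.Im (F z)) y.
Proof.
rewrite -sum_complex; apply: eq_bigr => i _; rewrite -sum_complex.
apply: eq_bigr => j _; rewrite realM_complex; congr ((_ * _) +i* (_ * _)).
  by apply: eq_derive => z; rewrite realM_complex.
by apply: eq_derive => z; rewrite realM_complex.
Qed.

Section Twice.
Context {n : nat}.
Implicit Types (f g : 'rV[R]_n.+1 -> R) (D : 'I_n.+1 -> 'rV[R]_n.+1 -> R).

(** The gradient is given at every point because it is differentiated again; differentiability of
    its components makes the flux differentiable. *)
Definition twice_diff f D :=
  forall z, has_grad f z (D^~ z) /\ forall i, differentiable (D i) z.

Lemma differentiable_dual D z j : (forall i, differentiable (D i) z) ->
  differentiable (fun z => dual z (D^~ z) j) z.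
Proof.
move=> dD; have [dh _] := has_grad_height_inv z.
have dc k : differentiable (fun z : 'rV[R]_n.+1 => z 0 k) z.
  exact: differentiable_coord.
have -> : (fun z => dual z (D^~ z) j) =
    \sum_i (fun z : 'rV[R]_n.+1 => ((i == j)%:R + z 0 i * z 0 j) / height z * D i z).
  by apply/funext => y; rewrite fct_sumE.
apply: differentiable_sum => i; apply: differentiableM; last exact: dD.
apply: differentiableM; last exact: dh.
apply: differentiableD; first exact: differentiable_cst.
exact: differentiableM.
Qed.

(** Exchanging the sums and moving the inner one under the derivative gives tau f = |g|^(-1/2) div
    (|g|^(1/2) grad f), with |g|^(-1/2) = [height y]. *)
Lemma rtau_div f D y : twice_diff f D ->
  rtau f y = height y * \sum_j 'D_(ev j) (fun z => dual z (D^~ z) j) y.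
Proof.
move=> fD; rewrite /rtau exchange_big mulr_sumr; apply: eq_bigr => j _ /=.
rewrite -mulr_sumr hyp_sqrtdetE invrK; congr (_ * _).
have [dh _] := has_grad_height_inv y.
have dc k : differentiable (fun z : 'rV[R]_n.+1 => z 0 k) y.
  exact: differentiable_coord.
have -> : (fun z => dual z (D^~ z) j) =
    \sum_i (fun z : 'rV[R]_n.+1 => ((i == j)%:R + z 0 i * z 0 j) / height z * D i z).
  by apply/funext => z; rewrite fct_sumE.
rewrite derive_sum => [|i].
  apply: eq_bigr => i _; apply: eq_derive => z.
  by rewrite invmx_metricE hyp_sqrtdetE; have [[_ ->] _] := fD z.
apply: diff_derivable.
apply: differentiableM; last by have [] := fD y.
apply: differentiableM; last exact: dh.
apply: differentiableD; first exact: differentiable_cst.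
exact: differentiableM.
Qed.

(** Needed because the real and imaginary parts of a complex product are sums of two separated real
    functions. *)
Lemma rtauD f g D E y : twice_diff f D -> twice_diff g E ->
  rtau (fun z => f z + g z) y = rtau f y + rtau g y.
Proof.
move=> fD gE; have fgDE : twice_diff (fun z => f z + g z) (fun i z => D i z + E i z).
  move=> z; have [fg df] := fD z; have [gg dg] := gE z.
  by split=> [|i]; [exact: has_gradD | apply: differentiableD].
rewrite (rtau_div y fgDE) (rtau_div y fD) (rtau_div y gE) -mulrDr -big_split.
congr (_ * _); apply: eq_bigr => j _ /=.
rewrite -[RHS]deriveD.
- apply: eq_derive => z; rewrite /dual fctE -big_split.
  by apply: eq_bigr => i _; rewrite mulrDr.
- by apply/diff_derivable/differentiable_dual; have [] := fD y.
- by apply/diff_derivable/differentiable_dual; have [] := gE y.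
Qed.

End Twice.

Section Separated.
Context {n : nat} (w w1 w2 : R -> R) (H : 'rV[R]_n -> R).
Hypothesis w_w1 : forall t : R, is_derive t 1 w (w1 t).
Hypothesis w1_w2 : forall t : R, is_derive t 1 w1 (w2 t).
Hypothesis H_diff : forall x, differentiable H x.
Hypothesis DH_diff : forall k x, differentiable ('D_(ev k) H) x.

Let f (z : 'rV[R]_n.+1) := w (log_depth z) * H (horo z).
Let K k (z : 'rV[R]_n.+1) : R := 'D_(ev k) H (horo z).
Let DK l k (z : 'rV[R]_n.+1) : R := 'D_(ev l) ('D_(ev k) H) (horo z).
Let D i z : R := w1 (log_depth z) * dlog_depth z i * H (horo z)
  + w (log_depth z) * \sum_k K k z * dhoro k z i.

Let gradH z : has_grad (fun z => H (horo z)) z (fun i => \sum_k K k z * dhoro k z i).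
Proof. by apply: has_grad_comp => [|k]; [split | exact: has_grad_horo]. Qed.

Let gradK k z : has_grad (K k) z (fun i => \sum_l DK l k z * dhoro l z i).
Proof.
apply: (@has_grad_comp _ _ _ ('D_(ev k) H)) => [|l]; last exact: has_grad_horo.
by split=> //; exact: DH_diff.
Qed.

Let gradw (z : 'rV[R]_n.+1) : has_grad (fun z => w (log_depth z)) z
  (fun i => w1 (log_depth z) * dlog_depth z i).
Proof. exact: has_grad_comp1 (has_grad_log_depth z). Qed.

Let gradw1 (z : 'rV[R]_n.+1) : has_grad (fun z => w1 (log_depth z)) z
  (fun i => w2 (log_depth z) * dlog_depth z i).
Proof. exact: has_grad_comp1 (has_grad_log_depth z). Qed.

Lemma twice_diff_separated : twice_diff f D.
Proof.
move=> z; split=> [|i]; first exact: has_gradM (gradw z) (gradH z).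
have [dw _] := gradw z; have [dw1 _] := gradw1 z; have [dH _] := gradH z.
have [dS _] := has_grad_null_inv z; have [dh _] := has_grad_height_inv z.
have dc k : differentiable (fun z : 'rV[R]_n.+1 => z 0 k) z.
  exact: differentiable_coord.
have dd : differentiable (fun z : 'rV[R]_n.+1 => z 0 i / height z + (i == 0)%:R) z.
  apply: differentiableD; last exact: differentiable_cst.
  exact: differentiableM.
apply: differentiableD; apply: differentiableM => //.
  apply: differentiableM => //; apply: differentiableM => //.
  exact: (differentiableN dS).
have -> : (fun z => \sum_k K k z * dhoro k z i) = \sum_k (fun z : 'rV[R]_n.+1 => K k z * dhoro k z i).
  by apply/funext => y; rewrite fct_sumE.
apply: differentiable_sum => k; apply: differentiableM.
  by have [] := gradK k z.
apply: differentiableB.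
  apply: differentiableM; last exact: differentiable_cst.
  by apply: differentiableM => //; exact: differentiable_cst.
apply: differentiableM => //; apply: differentiableM.
  by apply: differentiableM => //; exact: differentiable_cst.
under eq_fun do rewrite -exprVn expr2.
exact: differentiableM.
Qed.

(** [dual] is linear in the covector, so the flux of [f] is a combination of the fields whose
    divergences are known. *)
Let dualD (z : 'rV[R]_n.+1) j : dual z (D^~ z) j =
  w1 (log_depth z) * H (horo z) * log_field j z
  + w (log_depth z) * \sum_k K k z * horo_field k j z.
Proof.
rewrite -dual_log_depth; under eq_bigr do rewrite -dual_horo /dual mulr_sumr.
rewrite exchange_big /dual !mulr_sumr -big_split; apply: eq_bigr => i _ /=.
rewrite /D mulrDr; congr (_ + _); first by ring.
rewrite mulrCA; congr (_ * _); rewrite mulr_sumr; apply: eq_bigr => k _; ring.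
Qed.

Hypothesis H_harm : forall x, \sum_k 'D_(ev k) ('D_(ev k) H) x = 0.

(** The product rule for the divergence of the flux leaves six terms. The mixed pairings of u and
    x_k and the divergence of [horo_field] vanish, and the pairing of the x_k among themselves gives
    a multiple of the Laplacian of [H]. What survives is |grad u|^2 = 1 with w'' and tau u = -n with
    w'. *)
Lemma rtau_separated y :
  rtau f y = (w2 (log_depth y) - n%:R * w1 (log_depth y)) * H (horo y).
Proof.
have h0 := height_neq0 y.
rewrite (rtau_div y twice_diff_separated).
(* The gradient of component [j] of the flux; the divergence uses its diagonal. *)
pose G j i := (w2 (log_depth y) * dlog_depth y i * H (horo y)
    + w1 (log_depth y) * \sum_(k < n) K k y * dhoro k y i) * log_field j y
  + w1 (log_depth y) * H (horo y) * dlog_field j y i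
  + (w1 (log_depth y) * dlog_depth y i * (\sum_(k < n) K k y * horo_field k j y)
   + w (log_depth y) * \sum_(k < n) ((\sum_(l < n) DK l k y * dhoro l y i) * horo_field k j y
                        + K k y * dhoro_field k j y i)).
have grad_dual j : has_grad (fun z => dual z (D^~ z) j) y (G j).
  under eq_fun do rewrite dualD.
  apply: has_gradD (has_gradM (has_gradM (gradw1 y) (gradH y)) (has_grad_log_field j y))
    (has_gradM (gradw y) (has_grad_sum (fun k => has_gradM (gradK k y)
      (has_grad_horo_field k j y)))).
under eq_bigr => j _ do have [_ ->] := grad_dual j.
have hlog : \sum_(k < n) K k y * (\sum_j dhoro k y j * log_field j y) = 0.
  by rewrite big1 // => k _; rewrite horo_log mulr0.
have logh : \sum_(k < n) K k y * (\sum_j dlog_depth y j * horo_field k j y) = 0.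
  by rewrite big1 // => k _; rewrite log_horo mulr0.
have divh : \sum_(k < n) K k y * (\sum_j dhoro_field k j y j) = 0.
  by rewrite big1 // => k _; rewrite div_horo_field mulr0.
have hh : \sum_(k < n) \sum_(l < n) DK l k y * (\sum_j dhoro l y j * horo_field k j y) = 0.
  under eq_bigr => k _ do under eq_bigr => l _ do
    rewrite horo_horo mulrA.
  under eq_bigr => k _ do rewrite sum_deltar.
  by rewrite -mulr_suml H_harm mul0r.
suff -> : \sum_j G j j =
    w2 (log_depth y) * H (horo y) * \sum_j dlog_depth y j * log_field j y
  + w1 (log_depth y) * (\sum_(k < n) K k y * (\sum_j dhoro k y j * log_field j y))
  + w1 (log_depth y) * H (horo y) * (\sum_j dlog_field j y j)
  + w1 (log_depth y) * (\sum_(k < n) K k y * (\sum_j dlog_depth y j * horo_field k j y))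
  + w (log_depth y) * (\sum_(k < n) \sum_(l < n) DK l k y * (\sum_j dhoro l y j * horo_field k j y))
  + w (log_depth y) * (\sum_(k < n) K k y * (\sum_j dhoro_field k j y j)).
  rewrite hlog logh divh hh log_log div_log_field; field; exact: h0.
(* The sum over [j] is moved outermost in the four nested sums, so that the two sides can be
   compared for each [j]. *)
under [X in _ + _ * X + _ + _ + _ + _]eq_bigr do rewrite mulr_sumr.
rewrite [X in _ + _ * X + _ + _ + _ + _]exchange_big.
under [X in _ + _ * X + _ + _]eq_bigr do rewrite mulr_sumr.
rewrite [X in _ + _ * X + _ + _]exchange_big.
under [X in _ + _ * X]eq_bigr do rewrite mulr_sumr.
rewrite [X in _ + _ * X]exchange_big.
have -> : \sum_(k < n) \sum_(l < n) DK l k y * (\sum_j dhoro l y j * horo_field k j y) =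
  \sum_j \sum_(k < n) (\sum_(l < n) DK l k y * dhoro l y j) * horo_field k j y.
  rewrite [RHS]exchange_big; apply: eq_bigr => k _ /=.
  under [RHS]eq_bigr do rewrite mulr_suml.
  rewrite [RHS]exchange_big; apply: eq_bigr => l _ /=.
  by rewrite mulr_sumr; apply: eq_bigr => j _; rewrite mulrA.
rewrite !mulr_sumr -!big_split; apply: eq_bigr => j _.
rewrite /G big_split mulrDl.
have -> : w1 (log_depth y) * (\sum_(k < n) K k y * dhoro k y j) * log_field j y =
    w1 (log_depth y) * (\sum_(k < n) K k y * (dhoro k y j * log_field j y)).
  rewrite -mulrA mulr_suml; congr (_ * _).
  by apply: eq_bigr => k _; rewrite mulrA.
have -> : w1 (log_depth y) * dlog_depth y j * (\sum_(k < n) K k y * horo_field k j y) =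
    w1 (log_depth y) * (\sum_(k < n) K k y * (dlog_depth y j * horo_field k j y)).
  rewrite -mulrA mulr_sumr; congr (_ * _).
  by apply: eq_bigr => k _; rewrite mulrCA.
rewrite /=; ring.
Qed.

End Separated.
End Operator.

(** * Iterates *)

(** With [c] = -n this is w'' - n w' on polynomials; conjugating that operator by e^(nt) turns it
    into the case [c] = n, since 0 and n are its characteristic roots. *)
Definition shift_deriv (K : comNzRingType) (c : K) (p : {poly K}) : {poly K} :=
  p^`()^`() + c *: p^`().

Lemma iter_shift_deriv (K : comNzRingType) (c : K) k (p : {poly K}) :
  (size p <= k.+1)%N ->
  iter k (shift_deriv c) p = (p`_k * k`!%:R * c ^+ k)%:P.
Proof.
elim: k p => [|k IHk] p sp /=; first by rewrite fact0 !mulr1; exact: size1_polyC.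
rewrite -iterS iterSr IHk; last first.
  apply/leq_sizeP => j kj; rewrite coefD coefZ !coef_deriv.
  have sj i : (k.+1 < i)%N -> p`_i = 0 by move=> ki; rewrite nth_default // (leq_trans sp).
  by rewrite !sj ?mul0rn ?mulr0 ?addr0 // ltnS ltnW.
(* Coefficient [k] of the second derivative is a multiple of coefficient [k.+2] of [p], which is
   zero. *)
rewrite coefD coefZ !coef_deriv (@nth_default _ _ p k.+2) // !mul0rn add0r.
rewrite factS natrM exprS; congr (_%:P); rewrite -mulr_natr; ring.
Qed.

(** * A family of functions closed under the operator *)

Section Family.
Context {R : realType} {n : nat}.
Local Notation ev i := (@evec R _ i).

(** Keeping [c] and [d] outside the real polynomials lets one pair [P], [Q] serve the real and
    imaginary parts of [a] and [b] alike. *)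
Definition profile (c d : R) (P Q : {poly R}) (t : R) : R :=
  c * P.[t] + d * (Q.[t] * expR (n%:R * t)).

Lemma is_derive_profile c d P Q (t : R) : is_derive t 1 (profile c d P Q)
  (profile c d P^`() (Q^`() + n%:R *: Q) t).
Proof.
have dN : is_derive t 1 (fun t : R => n%:R * t) n%:R.
  have := is_deriveZ (n%:R : R) (is_derive_id t (1 : R)).
  by rewrite /GRing.scale /= mulr1.
have dE := @is_derive1_comp R expR (fun t => n%:R * t) t _ _ (is_derive_expR _) dN.
have dQ := is_deriveM (is_derive_poly Q t) dE.
have dW := is_deriveD (is_deriveZ c (is_derive_poly P t)) (is_deriveZ d dQ).
apply: (is_derive_eq dW); rewrite /profile /GRing.scale /= hornerD hornerZ; ring.
Qed.

Variables (h : 'rV[R]_n -> R[i]) (a b : R[i]).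
Hypothesis h_harm : eucl_harmonic h.

(** The shape of p_r(t) h(x) with log t = u and t^n = e^(nu), the power of the logarithm being
    relaxed to two independent polynomials. *)
Definition family P Q (y : 'rV[R]_n.+1) : R[i] :=
  (a * (P.[log_depth y])%:C
   + b * (Q.[log_depth y] * expR (n%:R * log_depth y))%:C) * h (horo y).

Let hr x := complex.Re (h x).
Let hi x := complex.Im (h x).

Lemma rtau_profile c d P Q H (y : 'rV[R]_n.+1) :
  (forall x, differentiable H x) ->
  (forall k x, differentiable ('D_(ev k) H) x) ->
  (forall x, \sum_k 'D_(ev k) ('D_(ev k) H) x = 0) ->
  rtau (fun z => profile c d P Q (log_depth z) * H (horo z)) y =
  profile c d (shift_deriv (- n%:R) P) (shift_deriv n%:R Q) (log_depth y) * H (horo y).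
Proof.
move=> dH dDH H0; rewrite (rtau_separated (is_derive_profile c d P Q)
  (is_derive_profile c d _ _) dH dDH H0); congr (_ * _).
rewrite /profile /shift_deriv !(hornerD, hornerZ, derivD, derivZ); ring.
Qed.

Let hr_diff x : differentiable hr x. Proof. by have [/(_ [::] x) []] := h_harm. Qed.
Let hi_diff x : differentiable hi x. Proof. by have [/(_ [::] x) []] := h_harm. Qed.
Let Dhr_diff k x : differentiable ('D_(ev k) hr) x.
Proof. by have [/(_ [:: k] x) []] := h_harm. Qed.
Let Dhi_diff k x : differentiable ('D_(ev k) hi) x.
Proof. by have [/(_ [:: k] x) []] := h_harm. Qed.

Let laplacian_parts x : \sum_k 'D_(ev k) ('D_(ev k) hr) x = 0 /\
   \sum_k 'D_(ev k) ('D_(ev k) hi) x = 0.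
Proof.
have [_ /(_ x)] := h_harm; rewrite /eucl_laplacian sum_complex => /eqP.
by rewrite eq_complex /= => /andP[/eqP -> /eqP ->].
Qed.

Let hr_harm x := (laplacian_parts x).1.
Let hi_harm x := (laplacian_parts x).2.

(** The sign from i^2 is absorbed into the coefficients, which leaves two separated real
    functions. *)
Lemma Re_family P Q y : complex.Re (family P Q y) =
  profile (complex.Re a) (complex.Re b) P Q (log_depth y) * hr (horo y)
  + profile (- complex.Im a) (- complex.Im b) P Q (log_depth y) * hi (horo y).
Proof.
rewrite /family /hr /hi /profile; case: a b (h _) => [ar ai] [br bi] [u v] /=; ring.
Qed.

Lemma Im_family P Q y : complex.Im (family P Q y) =
  profile (complex.Re a) (complex.Re b) P Q (log_depth y) * hi (horo y)
  + profile (complex.Im a) (complex.Im b) P Q (log_depth y) * hr (horo y).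
Proof.
rewrite /family /hr /hi /profile; case: a b (h _) => [ar ai] [br bi] [u v] /=; ring.
Qed.

Lemma hyp_tau_family P Q :
  hyp_tau (family P Q) = family (shift_deriv (- n%:R) P) (shift_deriv n%:R Q).
Proof.
apply/funext => y; rewrite hyp_tau_rtau.
have rsep c d (H : 'rV[R]_n -> R) (dH : forall x, differentiable H x)
    (dDH : forall k x, differentiable ('D_(ev k) H) x) :=
  twice_diff_separated (is_derive_profile c d P Q) (is_derive_profile c d _ _) dH dDH.
rewrite (funext (Re_family P Q)) (funext (Im_family P Q)).
rewrite (rtauD y (rsep _ _ _ hr_diff Dhr_diff) (rsep _ _ _ hi_diff Dhi_diff)).
rewrite (rtauD y (rsep _ _ _ hi_diff Dhi_diff) (rsep _ _ _ hr_diff Dhr_diff)).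
by rewrite !rtau_profile // -Re_family -Im_family; case: (family _ _ y).
Qed.

Lemma iter_hyp_tau_family k P Q : iter k (@hyp_tau R n.+1) (family P Q) =
  family (iter k (shift_deriv (- n%:R)) P) (iter k (shift_deriv n%:R) Q).
Proof. by elim: k => //= k ->; rewrite hyp_tau_family. Qed.

(** On the hyperboloid the square root equals 1, so the argument of p_r is t = 2 / s. *)
Lemma in_chart_thm_f r :
  in_chart (@thm_f R n.+1 r a b h) = family 'X^(r.-1) 'X^(r.-1).
Proof.
apply/funext => y; rewrite /in_chart /thm_f /= minkowski_chart opprK sqrtr1 mulr1.
(* Ambient indices are one above chart indices, as y_0 is not a chart coordinate. *)
have -> : inord 1 = lift ord0 ord0 :> 'I_n.+2.
  by apply: val_inj; rewrite /= inordK.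
rewrite hyp_chart0 hyp_chart_lift -/(null_coord y) /p_fun /family !hornerXn.
congr (_ * h _); last first.
  apply/rowP => j; rewrite !mxE.
  have -> : inord j.+2 = lift ord0 (lift ord0 j) :> 'I_n.+2.
    by apply: val_inj; rewrite /= inordK // !ltnS.
  by rewrite liftK.
have t0 : 0 < 2 / null_coord y by rewrite divr_gt0 ?null_coord_gt0.
rewrite expRM_natl lnK ?posrE // mulrDl -mulrA; congr (_ + b * _).
by rewrite mulrC rmorphM.
Qed.

End Family.

(** * Vanishing of the last iterate and non-vanishing of the one before *)

Theorem theorem4p3 (R : realType) (n : nat) (hn : (2 <= n)%N)
  (h : 'rV[R]_n.-1 -> R[i])
  (h_harm : eucl_harmonic h) (h_nonconst : exists x y, h x != h y)
  (r : nat) (hr : (1 <= r)%N) (a b : R[i]) (hab : (a, b) != (0, 0)) :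
  hyp_proper_r_harmonic r (@thm_f R n r a b h).
Proof.
(* From here [n] is the dimension minus one, hence positive, and after the next line [r] is the
   order minus one. *)
case: n hn h h_harm h_nonconst => [//|n] n0 h h_harm h_nonconst.
case: r hr => [//|r] _; rewrite /hyp_proper_r_harmonic /hyp_r_harmonic /=.
(* After [r] steps both copies of X^r have become constants, r! (-n)^r and r! n^r, which the one
   remaining step annihilates. *)
rewrite in_chart_thm_f iter_hyp_tau_family // !iter_shift_deriv ?size_polyXn //.
rewrite !coefXn eqxx mul1r; split=> [y|].
  rewrite hyp_tau_family // /shift_deriv !derivC ?deriv0 !scaler0 addr0 /family.
  by rewrite !horner0 !(mul0r, mulr0, addr0).
rewrite ltnS in n0.
have nC0 : n%:R != 0 :> R by rewrite pnatr_eq0 -lt0n.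
have kappa0 : r`!%:R * n%:R ^+ r != 0 :> R.
  by rewrite mulf_neq0 ?expf_neq0 // pnatr_eq0 -lt0n fact_gt0.
have kappa'0 : r`!%:R * (- n%:R) ^+ r != 0 :> R.
  by rewrite mulf_neq0 ?expf_neq0 ?oppr_eq0 // pnatr_eq0 -lt0n fact_gt0.
have [x hx] : exists x, h x != 0.
  have [x [y hxy]] := h_nonconst; have [x0|] := eqVneq (h x) 0; last by exists x.
  by exists y; rewrite eq_sym -x0.
(* Two points over the same [x], at heights t = 1 and t = 2, suffice to separate the constant from
   t^n. *)
have [y1 [s1 x1]] := @horo_surj R n 2 x (ltr0Sn R 1).
have [y2 [s2 x2]] := @horo_surj R n 1 x (@ltr01 R).
apply: contrapT => none; move/eqP: hab; apply.
(* If the iterate vanished everywhere, the nonzero factor h(x) could be cancelled at every point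
   over [x]. *)
have zero y : horo y = x -> a * (r`!%:R * (- n%:R) ^+ r)%:C +
   b * (r`!%:R * n%:R ^+ r * (2 / null_coord y) ^+ n)%:C = 0.
  move=> yx; apply: contrapT => /eqP ny; apply: none; exists y.
  rewrite /family !hornerC yx mulf_neq0 // expRM_natl lnK //.
  by rewrite posrE divr_gt0 ?null_coord_gt0.
have := zero y1 x1; have := zero y2 x2; rewrite s1 s2.
rewrite divff ?pnatr_eq0 // divr1 expr1n mulr1 => E1 E2.
have pow1 : 2 ^+ n - 1 != 0 :> R.
  by rewrite subr_eq0 gt_eqF // exprn_egt1 ?ltr1n // -lt0n.
(* Subtracting the equation at t = 1 from that at t = 2 eliminates [a] and forces [b] = 0; the
   equation at t = 1 then gives [a] = 0. *)
have /eqP : b * (r`!%:R * n%:R ^+ r * (2 ^+ n - 1))%:C = 0.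
  have := congr2 (fun u v => u - v) E1 E2; rewrite subrr => <-.
  rewrite mulrBr mulr1 rmorphB /=; ring.
rewrite mulf_eq0 fmorph_eq0 (negbTE (mulf_neq0 kappa0 pow1)) orbF => /eqP b0.
move: E2; rewrite b0 mul0r addr0 => /eqP.
by rewrite mulf_eq0 fmorph_eq0 (negbTE kappa'0) orbF => /eqP ->.
Qed.
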